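(* Consider the identification game with $d=4$, $n=3$, in which Alice sends a qutrit to Bob using the encoding $x_i\mapsto|\phi_i\rangle$, $i=1,2,3,4$, where $|\phi_1\rangle,|\phi_2\rangle,|\phi_3\rangle\in\mathbb{C}^3$ are linearly independent unit vectors and $|\phi_4\rangle\in\mathbb{C}^3$ is a unit vector. Then the game is won with this encoding (for a suitable decoding by Bob) if and only if $|\phi_4\rangle$ has coherence rank three with respect to the basis $\{|\phi_1\rangle,|\phi_2\rangle,|\phi_3\rangle\}$.
   Context: The game: a Referee sends Alice a value $x_i$ of a random variable with values $\{x_1,x_2,x_3,x_4\}$ and simultaneously sends Bob an index $j\in\{1,2,3,4\}$ with $x_i\in S_j$, where $S_1=\{x_1,x_2,x_3\}$, $S_2=\{x_1,x_3,x_4\}$, $S_3=\{x_1,x_2,x_4\}$, $S_4=\{x_2,x_3,x_4\}$. Alice does not know $j$; Bob knows only $j$. Alice sends Bob the pure state $|\phi_i\rangle$ of a qutrit (three-level quantum system, Hilbert space $\mathbb{C}^3$), and Bob performs a POVM $\{E^{(j)}_i: x_i\in S_j\}\cup\{E^{(j)}_?\}$ which may depend on $j$; outcome $i$ means he answers $x_i$ and outcome $?$ is inconclusive. No randomness or other correlations are used. The game is won if and only if for every $j$ and every $x_i\in S_j$ Bob identifies $x_i$ unambiguously with nonzero probability, i.e. $\langle\phi_i|E^{(j)}_i|\phi_i\rangle>0$ for all $x_i\in S_j$ and $\langle\phi_{i'}|E^{(j)}_i|\phi_{i'}\rangle=0$ for all $x_i,x_{i'}\in S_j$ with $i\neq i'$.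 A state $\mu_1|\phi_1\rangle+\mu_2|\phi_2\rangle+\mu_3|\phi_3\rangle$ has coherence rank three with respect to the (not necessarily orthogonal) basis $\{|\phi_1\rangle,|\phi_2\rangle,|\phi_3\rangle\}$ if $|\mu_i|>0$ for all $i=1,2,3$. *)

(* Defs.v *)
From mathcomp Require Import all_boot all_order all_algebra.
From mathcomp Require Import reals complex.

Set Implicit Arguments.
Unset Strict Implicit.
Unset Printing Implicit Defensive.

Import Order.TTheory GRing.Theory Num.Theory.
Local Open Scope ring_scope.
Local Open Scope sesquilinear_scope.

Section Quantum.

Variables (C : numClosedFieldType) (n : nat).

(* Kets are column vectors. *)
Definition braket (psi : 'cV[C]_n) (A : 'M[C]_n) (phi : 'cV[C]_n) : C :=
  (psi ^t* *m A *m phi) 0 0.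

Definition unit_ket (phi : 'cV[C]_n) : Prop := braket phi 1%:M phi = 1.

(* The order of C makes [0 <= z] mean that z is real and nonnegative. *)
Definition psd (A : 'M[C]_n) : Prop :=
  A \is hermsymmx /\ forall v : 'cV[C]_n, 0 <= braket v A v.

Definition povm (I : finType) (E : I -> 'M[C]_n) : Prop :=
  (forall o, psd (E o)) /\ \sum_o E o = 1%:M.

End Quantum.

(* The value x_k is represented by its index, and indices start from 0:
   [x1] is 0, ..., [x4] is 3; Bob's index j is shifted in the same way. *)
Definition x1 : 'I_4 := @Ordinal 4 0 isT.
Definition x2 : 'I_4 := @Ordinal 4 1 isT.
Definition x3 : 'I_4 := @Ordinal 4 2 isT.
Definition x4 : 'I_4 := @Ordinal 4 3 isT.

Definition candidates (j : 'I_4) : {set 'I_4} :=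
  nth set0 [:: [set x1; x2; x3]; [set x1; x3; x4];
               [set x1; x2; x4]; [set x2; x3; x4]] j.

(* [candidates j] is S_j; [Some i] is the answer x_i, [None] is the inconclusive outcome. *)
Definition outcome (j : 'I_4) : finType := option {i : 'I_4 | i \in candidates j}.

Section Game.

Variable C : numClosedFieldType.

Definition wins (phi : 'I_4 -> 'cV[C]_3)
    (E : forall j : 'I_4, outcome j -> 'M[C]_3) : Prop :=
  forall j : 'I_4,
    (forall i : {i : 'I_4 | i \in candidates j},
       0 < braket (phi (val i)) (E j (Some i)) (phi (val i))) /\
    (forall i i' : {i : 'I_4 | i \in candidates j}, i != i' ->
       braket (phi (val i')) (E j (Some i)) (phi (val i')) = 0).

Definition game_won (phi : 'I_4 -> 'cV[C]_3) : Prop :=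
  exists E : forall j : 'I_4, outcome j -> 'M[C]_3,
    (forall j, povm (E j)) /\ wins phi E.

(* [b] is meant to be a basis, so that the coefficients are unique. *)
Definition coherence_rank_three (b : 3.-tuple 'cV[C]_3) (psi : 'cV[C]_3) : Prop :=
  exists mu : 'I_3 -> C,
    psi = \sum_(i < 3) mu i *: tnth b i /\ forall i, 0 < `|mu i|.

End Game.

(* Main.v *)
(* If [phi4 = \sum_i mu i *: phi_i] with [mu k = 0], Bob fails on the S_j that
   omits [x_k]: the effect announcing [x4] has zero expectation, hence
   vanishes, on the other two kets of S_j, so it also vanishes on [phi4].
   Conversely, if no [mu i] is zero, any three of the four kets are linearly
   independent, and for each answer Bob can measure the projection on a vector
   orthogonal to the two other candidates. *)
Require Import Defs.
From HB Require Import structures.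
From mathcomp Require Import all_boot all_order all_algebra.
From mathcomp Require Import reals complex.
Local Open Scope ring_scope.

Import Order.TTheory GRing.Theory Num.Theory.
Local Open Scope sesquilinear_scope.

(** * Positive semidefinite matrices over a numeric closed field *)

Section PositiveMatrices.

Set Implicit Arguments.
Unset Strict Implicit.
Unset Printing Implicit Defensive.

Variable C : numClosedFieldType.

Lemma adjmxM (m n p : nat) (A : 'M[C]_(m, n)) (B : 'M[C]_(n, p)) :
  (A *m B)^t* = B^t* *m A^t*.
Proof. by rewrite trmx_mul map_mxM. Qed.

Lemma adjmxD (m n : nat) (A B : 'M[C]_(m, n)) : (A + B)^t* = A^t* + B^t*.
Proof. by rewrite linearD map_mxD. Qed.

Lemma adjmxN (m n : nat) (A : 'M[C]_(m, n)) : (- A)^t* = - A^t*.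
Proof. by rewrite linearN map_mxN. Qed.

Lemma adjmxZ (m n : nat) (a : C) (A : 'M[C]_(m, n)) :
  (a *: A)^t* = a^* *: A^t*.
Proof. by rewrite linearZ map_mxZ. Qed.

Lemma adjmx1 (n : nat) : (1%:M : 'M[C]_n)^t* = 1%:M.
Proof. by rewrite trmx1 map_mx1. Qed.

Lemma sqnorm_ketE (n : nat) (v : 'cV[C]_n) :
  (v^t* *m v) 0 0 = \sum_k `|v k 0| ^+ 2.
Proof.
rewrite mxE; apply: eq_bigr => k _.
by rewrite !mxE mulrC normCK.
Qed.

Lemma sqnorm_ket_ge0 (n : nat) (v : 'cV[C]_n) : 0 <= (v^t* *m v) 0 0.
Proof. by rewrite sqnorm_ketE sumr_ge0 // => k _; rewrite exprn_ge0. Qed.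

Lemma sqnorm_ket_eq0 (n : nat) (v : 'cV[C]_n) :
  (v^t* *m v) 0 0 = 0 -> v = 0.
Proof.
rewrite sqnorm_ketE => /eqP; rewrite psumr_eq0 => [/allP v0|k _]; last first.
  by rewrite exprn_ge0.
apply/colP => k; rewrite mxE; apply/eqP.
have := v0 k; rewrite mem_index_enum => /(_ isT).
by rewrite implyTb expf_eq0 normr_eq0.
Qed.

Lemma hermsymmxP (n : nat) (A : 'M[C]_n) :
  reflect (A^t* = A) (A \is hermsymmx).
Proof.
rewrite qualifE /= expr0 scale1r eq_sym; exact: eqP.
Qed.

(** The expectation at [v] is the squared norm of [A *m v]. Zero, the identity, projections and
    their complements are all Gram matrices, so their positivity comes from here. *)
Lemma psd_gram (m n : nat) (A : 'M[C]_(m, n)) : psd (A^t* *m A).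
Proof.
split; first by apply/hermsymmxP; rewrite adjmxM trmxCK.
move=> v; rewrite /braket.
have -> : v^t* *m (A^t* *m A) *m v = (A *m v)^t* *m (A *m v).
  by rewrite adjmxM !mulmxA.
exact: sqnorm_ket_ge0.
Qed.

Lemma psd0 (n : nat) : psd (0 : 'M[C]_n).
Proof. by have := psd_gram (0 : 'M[C]_n); rewrite mulmx0. Qed.

Lemma psd1 (n : nat) : psd (1%:M : 'M[C]_n).
Proof. by have := psd_gram (1%:M : 'M[C]_n); rewrite mulmx1 adjmx1. Qed.

Lemma psdD (n : nat) (A B : 'M[C]_n) : psd A -> psd B -> psd (A + B).
Proof.
move=> [/hermsymmxP hA pA] [/hermsymmxP hB pB]; split.
  by apply/hermsymmxP; rewrite adjmxD hA hB.
by move=> v; rewrite /braket mulmxDr mulmxDl mxE addr_ge0 ?pA ?pB.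
Qed.

Lemma psdZ (n : nat) (a : C) (A : 'M[C]_n) : 0 <= a -> psd A -> psd (a *: A).
Proof.
move=> a0 [/hermsymmxP hA pA]; split.
  by apply/hermsymmxP; rewrite adjmxZ hA geC0_conj.
by move=> v; rewrite /braket -scalemxAr -scalemxAl mxE mulr_ge0 ?pA.
Qed.

Lemma psd_sum (n : nat) (I : finType) (A : I -> 'M[C]_n) :
  (forall i, psd (A i)) -> psd (\sum_i A i).
Proof.
by move=> pA; apply: big_ind => // [|? ?]; [exact: psd0 | exact: psdD].
Qed.

(* Positivity at [v - t *: A v] for a small [t > 0] bounds [|A v|^2]. *)
Lemma psd_ker (n : nat) (A : 'M[C]_n) (v : 'cV[C]_n) :
  psd A -> braket v A v = 0 -> A *m v = 0.
Proof.
move=> [/hermsymmxP hA pA] v0; apply: sqnorm_ket_eq0.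
set u := A *m v; set s := (u^t* *m u) 0 0.
have s0 : 0 <= s by exact: sqnorm_ket_ge0.
have a0 := pA u; set a := braket u A u in a0 *.
have a1 : 0 < a + 1 by rewrite ltr_wpDl.
(* For [a > 0] the polynomial [t * (t * a - s *+ 2)] is least at [s / a]. The added [1] avoids a
   zero denominator and still gives [t * a <= s], so the value is at most [- (t * s)], negative when
   [s > 0]. *)
pose t := s / (a + 1).
have t0 : 0 <= t by rewrite divr_ge0 // ltW.
have expand : braket (v - t *: u) A (v - t *: u) = t * (t * a - s *+ 2).
  have vA : v^t* *m A = u^t* by rewrite adjmxM hA.
  have vAv : (u^t* *m v) 0 0 = 0 by rewrite -vA.
  rewrite /braket.
  have -> : (v - t *: u)^t* *m A *m (v - t *: u) =
      u^t* *m v - t *: (u^t* *m u + u^t* *m u - t *: (u^t* *m A *m u)).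
    rewrite adjmxD adjmxN adjmxZ geC0_conj // mulmxBl vA -scalemxAl.
    rewrite mulmxBl -!scalemxAl !mulmxBr -!scalemxAr -(mulmxA _ A v) -/u.
    by rewrite -addrA -opprD !(scalerDr, scalerN) !addrA.
  move: vAv; rewrite /a /s /braket; clearbody t; move: (u^t* *m v) => X.
  move: (u^t* *m u) (u^t* *m A *m u) => Y Z X0.
  by rewrite !mxE X0 add0r -mulrN opprB mulr2n.
have := pA (v - t *: u); rewrite expand => ge0.
apply/eqP; case: eqVneq => // sn0.
have sp : 0 < s by rewrite lt_def sn0.
have tp : 0 < t by rewrite divr_gt0.
move: ge0; rewrite pmulr_rge0 // subr_ge0 => le2.
have : t * a <= s.
  by rewrite /t mulrAC ler_pdivrMr // ler_wpM2l // lerDl.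
move/(le_trans le2); rewrite mulr2n gerDl => /(lt_le_trans sp).
by rewrite ltxx.
Qed.

(** * Rank-one projections and the measurement built from them *)

Definition ket_proj (n : nat) (w : 'cV[C]_n) : 'M[C]_n :=
  ((w^t* *m w) 0 0)^-1 *: (w *m w^t*).

Lemma ket_proj_herm (n : nat) (w : 'cV[C]_n) : (ket_proj w)^t* = ket_proj w.
Proof.
by rewrite adjmxZ adjmxM trmxCK geC0_conj // invr_ge0 sqnorm_ket_ge0.
Qed.

Lemma ket_proj_idem (n : nat) (w : 'cV[C]_n) :
  ket_proj w *m ket_proj w = ket_proj w.
Proof.
rewrite /ket_proj; set d := (w^t* *m w) 0 0.
(* Here [0^-1 = 0] by convention, so [ket_proj w] is the zero matrix. *)
have [-> | d0] := eqVneq d 0; first by rewrite invr0 scale0r mulmx0.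
rewrite -scalemxAl -scalemxAr scalerA mulmxA -(mulmxA w).
by rewrite [w^t* *m w]mx11_scalar -/d mul_mx_scalar -scalemxAl scalerA divfK.
Qed.

(** A Hermitian idempotent is its own Gram matrix; the complement below is handled the same way. *)
Lemma psd_ket_proj (n : nat) (w : 'cV[C]_n) : psd (ket_proj w).
Proof. by rewrite -ket_proj_idem -{1}ket_proj_herm; exact: psd_gram. Qed.

Lemma psd_ket_projC (n : nat) (w : 'cV[C]_n) : psd (1%:M - ket_proj w).
Proof.
have := psd_gram (1%:M - ket_proj w).
rewrite adjmxD adjmxN adjmx1 ket_proj_herm mulmxBr mulmx1 mulmxBl mul1mx.
by rewrite ket_proj_idem subrr subr0.
Qed.

Lemma braket_ket_proj (n : nat) (w v : 'cV[C]_n) :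
  braket v (ket_proj w) v = `|(w^t* *m v) 0 0| ^+ 2 / (w^t* *m w) 0 0.
Proof.
rewrite /braket /ket_proj -scalemxAr -scalemxAl mxE mulrC; congr (_ / _).
rewrite mulmxA -(mulmxA (_ *m w)) mxE big_ord1 normCK mulrC; congr (_ * _).
by rewrite -[in LHS](trmxCK w) -adjmxM !mxE.
Qed.

(* The weight [1 / (#|I| + 1)] makes the inconclusive effect a positive
   combination of [1%:M] and of the projections [1%:M - ket_proj (w i)]. *)
Definition unambiguous (n : nat) (I : finType) (w : I -> 'cV[C]_n)
    (o : option I) : 'M[C]_n :=
  if o is Some i then (#|I|.+1)%:R^-1 *: ket_proj (w i)
  else 1%:M - \sum_i (#|I|.+1)%:R^-1 *: ket_proj (w i).

Lemma povm_unambiguous (n : nat) (I : finType) (w : I -> 'cV[C]_n) :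
  povm (unambiguous w).
Proof.
have N0 : 0 <= (#|I|.+1)%:R^-1 :> C by rewrite invr_ge0 ler0n.
split=> [[i|]|] /=; first exact/psdZ/psd_ket_proj.
  have -> : 1%:M - \sum_i (#|I|.+1)%:R^-1 *: ket_proj (w i) =
      (#|I|.+1)%:R^-1 *: (1%:M + \sum_i (1%:M - ket_proj (w i))).
    rewrite -scaler_sumr big_split sumrN sumr_const /= addrA scalerDr scalerN.
    by rewrite -mulrS -scaler_nat scalerA mulVf ?scale1r ?pnatr_eq0.
  by apply/psdZ/psdD/psd_sum => // [|i]; [exact: psd1 | exact: psd_ket_projC].
(* The identity on [option I] serves as the partial inverse of [Some], which turns the conclusive
   terms into a sum over [I]. *)
rewrite (bigD1 None) //= (reindex_omap Some id) => [|[]] //=.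
by rewrite [X in _ + X](eq_bigl predT) ?subrK // => i; rewrite eqxx.
Qed.

Lemma unambiguous_gt0 (n : nat) (I : finType) (w : I -> 'cV[C]_n) i v :
  ((w i)^t* *m v) 0 0 != 0 -> 0 < braket v (unambiguous w (Some i)) v.
Proof.
move=> wv; rewrite /braket /= -scalemxAr -scalemxAl mxE.
rewrite mulr_gt0 ?invr_gt0 ?ltr0n // -/(braket _ _ _) braket_ket_proj.
rewrite divr_gt0 ?exprn_gt0 ?normr_gt0 // lt_def sqnorm_ket_ge0 andbT.
(* A nonzero overlap with [v] forces [w i] to be nonzero, so the normalising denominator is
   positive. *)
apply: contraNneq wv => /sqnorm_ket_eq0 ->.
by rewrite linear0 map_mx0 mul0mx mxE.
Qed.

Lemma unambiguous_eq0 (n : nat) (I : finType) (w : I -> 'cV[C]_n) i v :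
  ((w i)^t* *m v) 0 0 = 0 -> braket v (unambiguous w (Some i)) v = 0.
Proof.
move=> wv; rewrite /braket /= -scalemxAr -scalemxAl mxE -/(braket _ _ _).
by rewrite braket_ket_proj wv normr0 expr0n mul0r mulr0.
Qed.

(** Turns a functional into the ket representing it; the conjugation cancels the one in [^t*]. *)
Definition riesz (n : nat) (f : 'cV[C]_n -> C) : 'cV[C]_n :=
  \col_k (f (delta_mx k 0))^*.

Lemma rieszE (n : nat) (f : 'cV[C]_n -> C) (v : 'cV[C]_n) :
  scalar f -> ((riesz f)^t* *m v) 0 0 = f v.
Proof.
move=> f_lin.
pose fM := GRing.isLinear.Build C 'cV[C]_n C *%R f f_lin.
pose g : {scalar 'cV[C]_n} := HB.pack f fM.
rewrite -[RHS]/(g v) [in RHS](matrix_sum_delta v) linear_sum mxE.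
apply: eq_bigr => k _; rewrite big_ord1 linearZ.
by rewrite !mxE conjCK mulrC.
Qed.

End PositiveMatrices.

(** * The sets of candidates, and why winning forces nonzero coefficients *)

Section Game.

Set Implicit Arguments.
Unset Strict Implicit.
Unset Printing Implicit Defensive.

Variables (C : numClosedFieldType) (phi : 'I_4 -> 'cV[C]_3).

Let b := [tuple phi x1; phi x2; phi x3].

Hypothesis b_free : free b.

(* The index missing from [candidates j]. *)
Definition excluded (j : 'I_4) : 'I_4 := nth x1 [:: x4; x2; x3; x1] j.

(** Makes all four sets uniform: membership becomes being different from [excluded j]. *)
Lemma candidatesE (j : 'I_4) : candidates j = ~: [set excluded j].
Proof.
apply/setP => i; rewrite /candidates /excluded.
by case: j => [[|[|[|[|]]]]] // ?; case: i => [[|[|[|[|]]]]] // ?;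
  rewrite /= !inE.
Qed.

Lemma excluded_surj (k : 'I_4) : exists j, excluded j = k.
Proof.
case: k => [[|[|[|[|//]]]]] k4.
- by exists x4; apply: val_inj.
- by exists x2; apply: val_inj.
- by exists x3; apply: val_inj.
- by exists x1; apply: val_inj.
Qed.

Lemma x4E : x4 = ord_max.
Proof. exact: val_inj. Qed.

(** Basis indices embed into ['I_4] by [lift ord_max], whose image omits exactly [x4]. *)
Lemma tnth_lift (i : 'I_3) : tnth b i = phi (lift ord_max i).
Proof.
rewrite (tnth_nth 0).
by case: i => [[|[|[|//]]]] i3; congr phi; apply: val_inj.
Qed.

Lemma ket_expansion (v : 'cV[C]_3) : v = \sum_(i < 3) coord b i v *: tnth b i.
Proof.
have b_basis : basis_of fullv b.
  by rewrite basisEfree b_free subvf dimvf dim_matrix size_tuple.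
rewrite [LHS](coord_basis b_basis (memvf v)).
by apply: eq_bigr => i _; rewrite (tnth_nth 0).
Qed.

Lemma coherent_of_won : game_won phi -> coherence_rank_three b (phi x4).
Proof.
move=> [E [povmE winE]]; exists (fun i => coord b i (phi x4)).
split=> [|i]; first exact: ket_expansion.
rewrite normr_gt0; apply/negP => /eqP ci0.
have [j jE] := excluded_surj (lift ord_max i).
have x4j : x4 \in candidates j by rewrite candidatesE jE !inE x4E neq_lift.
have [/(_ (Sub x4 x4j)) pos zero] := winE j; have [psdE _] := povmE j.
move: pos; set F := E j _.
(* Only the right-hand ket is expanded: the term of index [i] has coefficient zero, and [F] kills
   the other two basis kets, which are candidates competing with [x4]. *)
have -> : braket (phi x4) F (phi x4) = 0; last by rewrite ltxx.
rewrite /braket -mulmxA [X in F *m X](ket_expansion (phi x4)) mulmx_sumr.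
rewrite big1 ?mulmx0 ?mxE // => k _; rewrite -scalemxAr.
have [-> | ki] := eqVneq k i; first by rewrite ci0 scale0r.
rewrite (_ : F *m _ = 0) ?scaler0 //; apply: psd_ker; first exact: psdE.
rewrite tnth_lift.
have kj : lift ord_max k \in candidates j.
  by rewrite candidatesE jE !inE (inj_eq lift_inj).
have x4k : Sub x4 x4j != Sub (lift ord_max k) kj :> {i | i \in candidates j}.
  by rewrite -val_eqE !SubK x4E neq_lift.
exact: zero x4k.
Qed.

(** * Bob's measurement when all coefficients are nonzero *)

Section Decoding.

Variable mu : 'I_3 -> C.
Hypothesis phi4 : phi x4 = \sum_(i < 3) mu i *: tnth b i.
Hypothesis mu_neq0 : forall i, mu i != 0.

(* Coefficients of the linear relation [\sum_i rel_coef i *: phi i = 0]. *)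
Definition rel_coef (i : 'I_4) : C :=
  if unlift ord_max i is Some a then mu a else -1.

(** The dual basis of [b], padded with the zero functional at [x4] so that all four indices are
    treated alike. *)
Definition dual_coord (i : 'I_4) (v : 'cV[C]_3) : C :=
  if unlift ord_max i is Some a then coord b a v else 0.

(* Among the functionals whose values on the kets are orthogonal to [rel_coef],
   this one vanishes outside [i] and [k]. *)
Definition discriminator (k i : 'I_4) (v : 'cV[C]_3) : C :=
  rel_coef k * dual_coord i v - rel_coef i * dual_coord k v.

Lemma discriminator_is_linear (k i : 'I_4) : scalar (discriminator k i).
Proof.
have lin l : scalar (dual_coord l).
  move=> a u v; rewrite /dual_coord; case: (unlift _ _) => [c|].
    by rewrite linearP.
  by rewrite mulr0 addr0.
move=> a u v; rewrite /discriminator !lin mulrBr !mulrDr !(mulrCA a).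
by rewrite opprD addrACA.
Qed.

Lemma rel_coef_neq0 (i : 'I_4) : rel_coef i != 0.
Proof.
rewrite /rel_coef; case: (unlift _ _) => [a|]; first exact: mu_neq0.
by rewrite oppr_eq0 oner_eq0.
Qed.

(** The coordinates of [phi x4] are the [mu a]. The extra [1] at [i = ord_max] offsets the
    coefficient [-1] there, since the padded functional is zero. *)
Lemma dual_coord_phi (i l : 'I_4) :
  dual_coord i (phi l) =
  if l == ord_max then rel_coef i + (i == ord_max)%:R else (i == l)%:R.
Proof.
rewrite /dual_coord /rel_coef.
case: (unliftP ord_max l) => [c ->|->]; last first.
  rewrite eqxx; case: (unliftP ord_max i) => [a ->|->]; last first.
    by rewrite eqxx addNr.
  rewrite eq_sym (negPf (neq_lift _ _)) addr0 -x4E phi4.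
  under eq_bigr do rewrite (tnth_nth 0).
  by rewrite coord_sum_free.
rewrite eq_sym (negPf (neq_lift _ _)).
case: (unliftP ord_max i) => [a ->|->]; last by rewrite (negPf (neq_lift _ _)).
by rewrite -tnth_lift (tnth_nth 0) coord_free // (inj_eq lift_inj) eq_sym.
Qed.

(** On a basis ket with [l != k] the second term vanishes. On [phi x4] the products
    [rel_coef k * rel_coef i] cancel, leaving [rel_coef k] only if [i] is [ord_max]. *)
Lemma discriminator_phi (k i l : 'I_4) : k != i -> l != k ->
  discriminator k i (phi l) = if l == i then rel_coef k else 0.
Proof.
move=> ki lk; rewrite /discriminator !dual_coord_phi (eq_sym k l) (negPf lk).
have [l4|l4] := eqVneq l ord_max; last first.
  by rewrite mulr0 subr0 (eq_sym i); case: eqP => _; rewrite ?mulr1 ?mulr0.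
move: lk; rewrite l4 (eq_sym _ k) => /negPf ->.
rewrite addr0 mulrDr (mulrC (rel_coef i)) addrC addKr (eq_sym i).
by case: eqP => _; rewrite ?mulr1 ?mulr0.
Qed.

Lemma won_of_coherent : game_won phi.
Proof.
(* Taking [k] to be the excluded index makes the functional vanish on the two other candidates and
   equal [rel_coef k], which is nonzero, on the announced one. *)
pose w j (i : {i : 'I_4 | i \in candidates j}) :=
  riesz (discriminator (excluded j) (val i)).
exists (fun j => unambiguous (w j)); split=> [j|j].
  exact: povm_unambiguous.
have neq_excl (i : {i : 'I_4 | i \in candidates j}) : val i != excluded j.
  by case: i => i /= ij; move: (ij); rewrite candidatesE !inE.
split=> [i|i i' ii'].
  apply: unambiguous_gt0; rewrite rieszE ?discriminator_phi ?eqxx ?rel_coef_neq0 //.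
    by rewrite eq_sym.
  exact: discriminator_is_linear.
apply: unambiguous_eq0; rewrite rieszE ?discriminator_phi //; last 2 first.
- by rewrite eq_sym.
- exact: discriminator_is_linear.
by rewrite val_eqE eq_sym (negPf ii').
Qed.

End Decoding.

End Game.

Theorem proposition6 (R : realType) (phi : 'I_4 -> 'cV[R[i]]_3)
    (phi_unit : forall k : 'I_4, unit_ket (phi k))
    (phi_free : free [tuple phi x1; phi x2; phi x3]) :
  game_won phi <->
  coherence_rank_three [tuple phi x1; phi x2; phi x3] (phi x4).
Proof.
split=> [|[mu [phi4 mu_gt0]]]; first exact: coherent_of_won.
apply: (won_of_coherent phi_free phi4) => i.
by rewrite -normr_gt0 mu_gt0.
Qed.
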